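(* Let $U(x)=\prod_{i=1}^m(1-\alpha_i x)$ and $V(x)=\prod_{j=1}^n(1-\beta_j x)$. Then $$\prod_{i=1}^m\prod_{j=1}^n(1-\alpha_i\beta_j x)=(-1)^{mn}\operatorname{Res}\bigl(U(y),\,y^nV(x/y),\,y\bigr).$$
   Context: The $\alpha_i$ and $\beta_j$ lie in an extension field of a field $F$ of characteristic $0$, and $x$ and $y$ are indeterminates. Given two polynomials $A(y)=\sum_{i=0}^m a_i y^i=a_m\prod_{i=1}^m(y-\rho_i)$ and $B(y)=\sum_{j=0}^n b_j y^j=b_n\prod_{j=1}^n(y-\sigma_j)$, their resultant with respect to the variable $y$ is defined by $\operatorname{Res}(A(y),B(y),y)=a_m^n b_n^m\prod_{i,j}(\rho_i-\sigma_j)$. It can be computed from the coefficients as the determinant of the $(m+n)\times(m+n)$ Sylvester matrix, whose first $n$ rows are the successive right shifts of $(a_m,\dots,a_0,0,\dots,0)$ and whose last $m$ rows are the successive right shifts of $(b_n,\dots,b_0,0,\dots,0)$. In the claim, the resultant is taken of $U(y)$ and $y^nV(x/y)=\prod_{j=1}^n(y-\beta_j x)$, regarded as polynomials in $y$. *)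

(* Defs.v *)
From mathcomp Require Import all_boot all_order all_algebra.

Set Implicit Arguments.
Unset Strict Implicit.
Unset Printing Implicit Defensive.

Import GRing.Theory.
Local Open Scope ring_scope.

(* A(y) = a_m \prod_i (y - rho_i) and B(y) = b_n \prod_j (y - sigma_j) over a
   field K containing the coefficient ring through f, with
   f r = a_m ^ n * b_n ^ m * \prod_(i, j) (rho_i - sigma_j).
   Here m and n are the actual degrees of A and B, since f is injective. *)
Definition is_resultant (R : idomainType) (A B : {poly R}) (r : R) : Prop :=
  [/\ A != 0, B != 0 &
  exists (K : fieldType) (f : {rmorphism R -> K}) (rho sigma : seq K),
  [/\ injective f,
      map_poly f A = f (lead_coef A) *: \prod_(a <- rho) ('X - a%:P),
      map_poly f B = f (lead_coef B) *: \prod_(b <- sigma) ('X - b%:P) &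
      f r = f (lead_coef A) ^+ size sigma * f (lead_coef B) ^+ size rho
            * \prod_(a <- rho) \prod_(b <- sigma) (a - b)]].

(* Row i is (p_d, ..., p_0, 0, ..., 0) shifted i places to the right. *)
Definition shifted_rows (R : nzRingType) (k N d : nat) (p : {poly R}) :
    'M[R]_(k, N) :=
  \matrix_(i < k, j < N) (if (i <= j <= i + d)%N then p`_(d + i - j) else 0).

(* The determinant for formal degrees m and n: the coefficients A`_m and B`_n
   may vanish. MathComp's resultant uses the actual degrees and lists
   coefficients from the lowest degree up, so that even when the degrees are
   m and n it differs from this one by the factor (-1) ^+ (m * n). *)
Definition sylvester_resultant (R : comNzRingType) (m n : nat)
    (A B : {poly R}) : R :=
  \det (col_mx (shifted_rows n (n + m) m A) (shifted_rows m (n + m) n B)).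

(* y^n V(x/y), for V of degree at most n; in {poly {poly L}} the outer
   variable 'X is y and 'X%:P is x. *)
Definition reversed_at (L : nzRingType) (n : nat) (V : {poly L}) :
    {poly {poly L}} :=
  \sum_(j < n.+1) (V`_j *: 'X^j)%:P * 'X^(n - j).

Lemma reversed_atE (L : fieldType) (n : nat) (V : {poly L}) :
  (size V <= n.+1)%N ->
  tofrac (reversed_at n V) =
    tofrac 'X ^+ n
    * (map_poly (@tofrac {poly {poly L}} \o (@polyC {poly L} \o @polyC L)) V)
        .[tofrac ('X%:P) / tofrac 'X].
Proof.
move=> sV; set g := (_ \o _).
have y0 : tofrac ('X : {poly {poly L}}) != 0 by rewrite tofrac_eq0 polyX_eq0.
rewrite (@horner_coef_wide _ n.+1); last by rewrite (leq_trans (size_poly _ _)).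
rewrite /reversed_at rmorph_sum mulr_sumr; apply: eq_bigr => j _ /=.
rewrite coef_map /g /= -mul_polyC !rmorphM !rmorphXn /= expr_div_n.
have jn : (j <= n)%N by rewrite -ltnS.
rewrite -[X in _ = tofrac 'X ^+ X * _](subnK jn) exprD -!mulrA.
rewrite [tofrac 'X ^+ j * _]mulrCA [tofrac 'X ^+ j * (_ / _)]mulrC.
rewrite divfK ?expf_neq0 // [RHS]mulrCA.
by congr (_ * _); rewrite mulrC.
Qed.

(* Main.v *)
Require Import Defs.
From mathcomp Require Import all_boot all_order all_algebra.
From mathcomp Require Import zify.

(** Both notions of resultant reduce to evaluations. If B is the product of
    the factors y - c for c in a sequence s, then Res(A, B) is, up to the sign
    (-1)^(mn), the product of the values A(c). Here A = U and B = y^n V(x/y) is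
    the product of the y - beta_j x, and U(beta_j x) is the product over i of
    the 1 - alpha_i beta_j x, so the claim follows.

    For the Sylvester determinant ([sylvester_resultant_prod_XsubC]) the value
    formula is proved over any commutative ring, so that coinciding roots or
    zero leading coefficients need no separate treatment. The rows of the
    Sylvester matrix are the polynomials y^(n-1), ..., y, 1 times A followed by
    the y^(m-1), ..., y, 1 times B. A unitriangular row operation replaces the
    powers of y that multiply A by the Newton basis 1, y - c_1,
    (y - c_1)(y - c_2), ... built on the roots of B. Every row but one, namely
    1 * A, is then divisible by y - c_1, and a determinant whose rows are
    divisible by y - c except for one row p is, up to sign, p(c) times the
    determinant of the quotients ([det_coefmx_root]). The quotients are again
    Newton rows, for the remaining roots, and induction applies
    ([det_newton_rows]).

    For the definition by roots ([is_resultant_prod_XsubC]), the roots of B in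
    any splitting field are forced to be the images of the elements of s, by
    unique factorization, and the product of the differences of roots
    regroups into the values of A at these roots. When no alpha_i vanishes, U
    has degree m and the roots 1 / alpha_i, so a splitting field exists, namely
    the fraction field of L[x]. *)

Set Implicit Arguments.
Unset Strict Implicit.
Unset Printing Implicit Defensive.

Import GRing.Theory.
Local Open Scope ring_scope.

(** * Determinants with polynomial rows *)

(** Coefficients decrease along a row, as in the Sylvester matrix, so that
    multiplying a polynomial by the variable shifts its row to the left and
    the constant coefficients occupy the last column. *)
Definition coefmx (R : nzRingType) (N : nat) (p : 'I_N -> {poly R}) : 'M[R]_N :=
  \matrix_(i < N, j < N) (p i)`_(N - j.+1).

(** Synthetic division by y - c is a unitriangular column operation: it turns
    the row of a polynomial into its quotient followed by its value at c. When c
    is a root of all rows but p k, the last column that results has p k (c) as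
    its only nonzero entry, and the cofactor of that entry is made of the
    quotients. *)
Lemma det_coefmx_root (R : comNzRingType) (N : nat) (c : R) (k : 'I_N.+1)
    (p : 'I_N.+1 -> {poly R}) (q : 'I_N -> {poly R}) :
  (forall i, p (lift k i) = ('X - c%:P) * q i) ->
  (forall i, size (q i) <= N)%N -> (size (p k) <= N.+1)%N ->
  \det (coefmx p) = (-1) ^+ (k + N) * (p k).[c] * \det (coefmx q).
Proof.
move=> pq sq sp.
have [t pt]: exists t : {poly R}, p k = t * ('X - c%:P) + (p k).[c]%:P.
  have /factor_theorem[t pt]: root (p k - (p k).[c]%:P) c.
    by rewrite rootE !hornerE subrr.
  by exists t; rewrite -pt subrK.
have st: (size t <= N)%N.
  have [->|t0] := eqVneq t 0; first by rewrite size_poly0.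
  have: (size (t * ('X - c%:P))%R <= N.+1)%N.
    rewrite -[t * _](addrK (p k).[c]%:P) -pt.
    rewrite (leq_trans (size_polyD _ _)) // geq_max sp size_polyN.
    by rewrite (leq_trans (size_polyC_leq1 _)).
  by rewrite size_Mmonic ?monicXsubC // size_XsubC addn2.
(* The quotient shifted up by one place, with the value at c as constant
   coefficient; multiplication by T undoes the synthetic division. *)
pose s i := if unlift k i is Some i' then q i' * 'X
            else t * 'X + (p k).[c]%:P.
pose T : 'M[R]_N.+1 := \matrix_(i, j) ((i == j)%:R - c *+ (i.+1 == j)).
have coef_p i d : (p i)`_d = (s i)`_d - c * (s i)`_d.+1.
  rewrite /s; case: unliftP => [i' ->|->].
    by rewrite pq mulrBl coefB coefCM -commr_polyX !coefMX.
  rewrite [in LHS]pt; move: (p k).[c] => v.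
  rewrite mulrBr coefD coefB coefMC [_ * c]mulrC !(coefD, coefC) !coefMX /=.
  by rewrite addr0 addrAC.
have size_s i : (size (s i) <= N.+1)%N.
  rewrite /s; case: (unlift k i) => [i'|].
    by rewrite (leq_trans (size_polyMleq _ _)) // size_polyX addn2 ltnS.
  rewrite (leq_trans (size_polyD _ _)) // geq_max.
  rewrite (leq_trans (size_polyMleq _ _)) ?size_polyX ?addn2 //=.
  by rewrite (leq_trans (size_polyC_leq1 _)).
have -> : coefmx p = coefmx s *m T.
  apply/matrixP=> i j; rewrite !mxE coef_p.
  under eq_bigr => l _ do rewrite !mxE mulrBr.
  rewrite sumrB; congr (_ - _).
    rewrite (bigD1 j) //= eqxx mulr1 big1 ?addr0 // => l /negPf->.
    by rewrite mulr0.
  case: j => [[|j] /= ltj].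
    rewrite big1 => [|l _]; last by rewrite mulr0n mulr0.
    by rewrite [_`_ _]nth_default ?mulr0 // subn1.
  rewrite (bigD1 (Ordinal (ltnW ltj))) //= eqxx.
  rewrite big1 ?addr0 => [|l]; last first.
    by rewrite -val_eqE /= eqSS => /negPf->; rewrite mulr0n mulr0.
  by rewrite mulr1n mulrC subSS -subSn.
rewrite det_mulmx.
have -> : \det T = 1.
  rewrite -det_tr det_trig.
    rewrite big1 // => i _; rewrite !mxE eqxx.
    by rewrite (gtn_eqF (ltnSn i)) subr0.
  apply/is_trig_mxP => i j ltij; rewrite !mxE -val_eqE.
  rewrite (gtn_eqF ltij) /= (gtn_eqF (ltnW _)) ?subr0 //.
rewrite mulr1 (expand_det_col _ ord_max) (bigD1 k) //= big1 => [|i ik].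
  rewrite addr0 mxE subnn /s unlift_none coefD coefMX coefC /= add0r.
  rewrite /cofactor mulrA [_ * (-1) ^+ _]mulrC; congr (_ * \det _).
  apply/matrixP=> i j; rewrite !mxE liftK coefMX /=.
  by rewrite /bump leqNgt ltn_ord add0n subSS subn_eq0 leqNgt ltn_ord /= subnS.
rewrite mxE subnn /s; case: unliftP ik => [i' _ _|->]; last by rewrite eqxx.
by rewrite coefMX mul0r.
Qed.

(** * The Sylvester determinant as a product of values *)

Definition newton (R : nzRingType) (s : seq R) (k : nat) : {poly R} :=
  \prod_(c <- take k s) ('X - c%:P).

Lemma size_newton (R : nzRingType) (s : seq R) (k : nat) :
  (k <= size s)%N -> size (newton s k) = k.+1.
Proof. by move=> ks; rewrite size_prod_XsubC size_takel. Qed.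

(** The Sylvester rows of A and of the polynomial with roots s, except that A
    is multiplied by Newton polynomials instead of powers of the variable. The
    formal degree of A is m. *)
Definition newton_rows (R : nzRingType) (m : nat) (A : {poly R}) (s : seq R)
    (i : nat) : {poly R} :=
  if (i < size s)%N then newton s (size s - i.+1) * A
  else newton s (size s) * 'X^(size s + m - i.+1).

Lemma newton_cons (R : nzRingType) (c : R) (s : seq R) (k : nat) :
  newton (c :: s) k.+1 = ('X - c%:P) * newton s k.
Proof. by rewrite /newton /= big_cons. Qed.

Lemma size_newton_rows (R : nzRingType) (m : nat) (A : {poly R})
    (s : seq R) (i : nat) :
  (size A <= m.+1)%N -> (i < size s + m)%N ->
  (size (newton_rows m A s i) <= size s + m)%N.
Proof.
move=> sA ltis; rewrite /newton_rows; case: ltnP => i_s.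
  rewrite (leq_trans (size_polyMleq _ _)) // size_newton ?leq_subr //=.
  by move: sA i_s; move: (size A) (size s) => a b; lia.
rewrite (leq_trans (size_polyMleq _ _)) // size_newton // size_polyXn /=.
by move: i_s ltis; move: (size s) => b; lia.
Qed.

(** Induction on s: only the row 1 * A fails to be divisible by the factor of
    the first root c; it contributes A.[c], and dividing the other rows by this
    factor leaves the Newton rows of the remaining roots. *)
Lemma det_newton_rows (R : comNzRingType) (m : nat) (A : {poly R}) (s : seq R) :
  (size A <= m.+1)%N ->
  \det (coefmx (fun i : 'I_(size s + m) => newton_rows m A s i))
    = (-1) ^+ (m * size s) * \prod_(c <- s) A.[c].
Proof.
move=> sA; elim: s => [|c s IHs].
  (* The rows are the powers of the variable, hence the identity matrix. *)
  rewrite big_nil muln0 mulr1 expr0 -[RHS](det1 _ m); congr (\det _).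
  apply/matrixP=> i j; rewrite !mxE /newton_rows ltn0 /newton big_nil mul1r.
  rewrite coefXn.
  congr (_ _)%:R; have := ltn_ord i; have := ltn_ord j.
  by rewrite -[i == j]val_eqE /=; lia.
pose k : 'I_(size s + m).+1 := inord (size s).
have kE : k = size s :> nat by rewrite inordK // ltnS leq_addr.
have pk : newton_rows m A (c :: s) k = A.
  by rewrite /newton_rows kE ltnSn subnn /newton big_nil mul1r.
(* k is the row 1 * A, the last one of the first block. *)
rewrite (@det_coefmx_root _ _ c k _ (fun i => newton_rows m A s i)).
- rewrite {}IHs big_cons pk kE addnA mulrACA -exprD; congr (_ * _).
  rewrite /= mulnS addnn -addnA exprD -[_ ^+ _.*2]signr_odd odd_double.
  by rewrite mul1r.
- move=> i; rewrite /newton_rows /= /bump kE; case: (ltnP i (size s)) => si.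
    by rewrite add0n ltnW // subSS -(subnSK si) newton_cons -mulrA.
  by rewrite add1n ltnNge ltnS si /= newton_cons -mulrA subSS.
- by move=> i; apply: size_newton_rows.
- by rewrite pk (leq_trans sA) // ltnS leq_addl.
Qed.

(** The degree bounds matter outside the band of the Sylvester matrix, where
    its entries are zero by definition. *)
Lemma sylvester_resultant_coefmx (R : comNzRingType) (m n : nat)
    (A B : {poly R}) :
  (size A <= m.+1)%N -> (size B <= n.+1)%N ->
  sylvester_resultant m n A B =
  \det (coefmx (fun i : 'I_(n + m) => if (i < n)%N then 'X^(n - i.+1) * A
                                      else B * 'X^(n + m - i.+1))).
Proof.
have shift_coef (C : {poly R}) d i j k N : (size C <= d.+1)%N ->
    (i < k)%N -> N = (k + d)%N -> (j < N)%N ->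
  (if (i <= j <= i + d)%N then C`_(d + i - j) else 0)
    = ('X^(k - i.+1) * C)`_(N - j.+1).
  move=> sC ik -> jN; rewrite coefXnM; case: ifP => [/andP[ij jd]|ij].
    rewrite ifN; last by lia.
    by congr (C`_ _); lia.
  case: ifP => [//|kj]; rewrite nth_default // (leq_trans sC) //; lia.
move=> sA sB; congr (\det _); apply/matrixP=> i j; rewrite !mxE.
case: splitP => i' ->; rewrite mxE.
  by rewrite (shift_coef A m i' j n (n + m)%N).
rewrite -addnS subnDl commr_polyXn.
by rewrite (shift_coef B n i' j m (n + m)%N) // addnC.
Qed.

(** The Newton polynomials are monic of degrees 0, ..., n - 1, so the change of
    basis T from powers of the variable to them has determinant 1. *)
Lemma sylvester_resultant_prod_XsubC (R : comNzRingType) (m : nat)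
    (A : {poly R}) (s : seq R) :
  (size A <= m.+1)%N ->
  sylvester_resultant m (size s) A (\prod_(c <- s) ('X - c%:P))
    = (-1) ^+ (m * size s) * \prod_(c <- s) A.[c].
Proof.
move=> sA; rewrite sylvester_resultant_coefmx ?size_prod_XsubC //.
rewrite -(det_newton_rows s sA).
set S := coefmx _; set W := coefmx _.
pose T : 'M[R]_(size s) :=
  \matrix_(i, j) (newton s (size s - i.+1))`_(size s - j.+1).
have detT: \det T = 1.
  rewrite -det_tr det_trig.
    rewrite big1 // => i _; rewrite !mxE.
    have /monicP: newton s (size s - i.+1) \is monic by apply: monic_prod_XsubC.
    by rewrite lead_coefE size_newton ?leq_subr.
  apply/is_trig_mxP=> i j ltij; rewrite !mxE nth_default //.
  by rewrite size_newton ?leq_subr //; have := ltn_ord j; move: ltij => /=; lia.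
have newtonE (i : 'I_(size s)) : newton s (size s - i.+1) =
    \sum_(l < size s) T i l *: 'X^(size s - l.+1).
  have: (size (newton s (size s - i.+1)) <= size s)%N.
    by rewrite size_newton ?leq_subr // -subSn // subSS leq_subr.
  move/take_poly_id=> {1}<-; rewrite /take_poly poly_def.
  rewrite (reindex_inj rev_ord_inj) /=; apply: eq_bigr => l _.
  by rewrite mxE.
have -> : W = block_mx T 0 0 1%:M *m S.
  apply/matrixP=> i j; rewrite !mxE big_split_ord /= /newton_rows.
  case: (split_ordP i) => i' -> /=; rewrite ?ltn_ord.
    rewrite newtonE mulr_suml coef_sum [X in _ + X]big1 ?addr0 => [|l _].
      apply: eq_bigr => l _; rewrite block_mxEul !mxE /= ltn_ord.
      by rewrite -scalerAl coefZ.
    by rewrite block_mxEur mxE mul0r.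
  rewrite big1 ?add0r => [|l _].
    rewrite (bigD1 i') //= block_mxEdr !mxE eqxx mul1r [X in _ + X]big1 ?addr0.
      by rewrite /= ltnNge leq_addr /newton take_size.
    by move=> l li; rewrite block_mxEdr !mxE eq_sym (negPf li) mul0r.
  by rewrite block_mxEdl mxE mul0r.
by rewrite det_mulmx det_ublock detT det1 !mul1r.
Qed.

(** * The resultant in terms of roots *)

(** The sign comes from replacing each factor x - y by y - x. *)
Lemma prod_root_differences (R : comNzRingType) (a : R) (s t : seq R) :
  a ^+ size t * \prod_(x <- s) \prod_(y <- t) (x - y)
    = (-1) ^+ (size s * size t)
      * \prod_(y <- t) (a *: \prod_(x <- s) ('X - x%:P)).[y].
Proof.
under [in RHS]eq_bigr => y _ do rewrite hornerZ horner_prod.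
rewrite big_split /= big_const_seq count_predT iter_mulr_1 mulrCA.
congr (_ * _); rewrite [in RHS]exchange_big /= exprM.
elim: s => [|x s IHs]; first by rewrite !big_nil expr0 expr1n mulr1.
rewrite !big_cons {}IHs /= exprS exprMn mulrACA; congr (_ * _).
elim: t => [|y t IHt]; first by rewrite !big_nil expr0 mulr1.
by rewrite !big_cons {}IHt /= exprS mulrACA !hornerE mulN1r opprB.
Qed.

(** The splitting field and the roots in the definition of the resultant are
    existentially quantified; the value formula shows that every choice gives
    the same r. One splitting of A is assumed so that a choice exists. *)
Lemma is_resultant_prod_XsubC (R : idomainType) (K : fieldType)
    (f : {rmorphism R -> K}) (A : {poly R}) (rho : seq K) (s : seq R) (r : R) :
  injective f -> A != 0 ->
  map_poly f A = f (lead_coef A) *: \prod_(a <- rho) ('X - a%:P) ->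
  is_resultant A (\prod_(c <- s) ('X - c%:P)) r <->
    r = (-1) ^+ ((size A).-1 * size s) * \prod_(c <- s) A.[c].
Proof.
have monB : \prod_(c <- s) ('X - c%:P) \is monic by apply: monic_prod_XsubC.
have mapB (E : fieldType) (g : {rmorphism R -> E}) :
    map_poly g (\prod_(c <- s) ('X - c%:P)) =
    \prod_(b <- [seq g c | c <- s]) ('X - b%:P).
  by rewrite prod_map_poly.
move=> inj_f A0 splitA.
have value (E : fieldType) (g : {rmorphism R -> E}) (rho' : seq E) :
    injective g ->
    map_poly g A = g (lead_coef A) *: \prod_(a <- rho') ('X - a%:P) ->
    g (lead_coef A) ^+ size s
      * \prod_(a <- rho') \prod_(b <- [seq g c | c <- s]) (a - b)
    = g ((-1) ^+ ((size A).-1 * size s) * \prod_(c <- s) A.[c]).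
  move=> inj_g splitA'; rewrite -(size_map g s) prod_root_differences -splitA'.
  rewrite big_map rmorphM rmorph_sign rmorph_prod.
  have -> : (size A).-1 = size rho'.
    rewrite -(size_map_inj_poly inj_g (rmorph0 g)) splitA' size_scale.
      by rewrite size_prod_XsubC.
    by rewrite (raddf_eq0 _ inj_g) lead_coef_eq0.
  by congr (_ * _); apply: eq_bigr => c _; rewrite horner_map.
split=> [[_ _ [E [g [rho' [sigma [inj_g splitA' splitB gr]]]]]]|->].
  apply: (inj_g); rewrite -(value _ _ rho') // gr.
  rewrite (monicP monB) rmorph1 expr1n mulr1.
  (* Unique factorization determines the roots of B up to their order. *)
  have ps : perm_eq sigma [seq g c | c <- s].
    apply: prod_XsubC_eq.
    by rewrite -mapB splitB (monicP monB) rmorph1 scale1r.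
  rewrite (perm_size ps) size_map; congr (_ * _).
  by apply: eq_bigr => a _; apply: perm_big.
split=> //; first exact: monic_neq0.
exists K, f, rho, [seq f c | c <- s]; split=> //.
  by rewrite mapB (monicP monB) rmorph1 scale1r.
by rewrite -(value _ _ rho) // (monicP monB) rmorph1 expr1n mulr1 size_map.
Qed.

(** * Reversed polynomials and the product formula *)

Lemma size_prod_1subZX (L : nzRingType) (s : seq L) :
  (size (\prod_(b <- s) (1 - b *: 'X))%R <= (size s).+1)%N.
Proof.
elim: s => [|b s IHs]; first by rewrite big_nil size_poly1.
rewrite big_cons (leq_trans (size_polyMleq _ _)) //=.
have: (size (1 - b *: 'X : {poly L})%R <= 2)%N.
  rewrite (leq_trans (size_polyD _ _)) // geq_max size_poly1 size_polyN.
  by rewrite (leq_trans (size_scale_leq _ _)) ?size_polyX.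
by move: IHs; move: (size _) (size s) (size _) => a d e; lia.
Qed.

(** Distributing y^n over the n factors 1 - b x / y clears the denominator of
    each of them; this is done in the fraction field, where x / y makes
    sense. *)
Lemma reversed_at_prod (L : fieldType) (s : seq L) :
  reversed_at (size s) (\prod_(b <- s) (1 - b *: 'X))
    = \prod_(b <- s) ('X - (b *: 'X)%:P).
Proof.
apply/eqP; rewrite -tofrac_eq; apply/eqP.
rewrite reversed_atE ?size_prod_1subZX //.
set g := (_ \o _); set y := tofrac 'X.
have y0 : y != 0 by rewrite tofrac_eq0 polyX_eq0.
elim: s => [|b s IHs].
  by rewrite !big_nil !rmorph1 hornerC mul1r.
rewrite !big_cons !rmorphM /= hornerM exprS mulrACA {}IHs; congr (_ * _).
rewrite !rmorphB !rmorph1 /= map_polyZ map_polyX.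
rewrite hornerD hornerN hornerC hornerZ hornerX mulrBr mulr1 /=.
congr (_ - _); rewrite mulrCA [_ / y]mulrC mulVKf //.
by rewrite -mul_polyC !rmorphM.
Qed.

Theorem theorem14 (F : fieldType) (charF : [pchar F] =i pred0)
    (L : fieldType) (iota : {rmorphism F -> L})
    (m n : nat) (alpha : 'I_m -> L) (beta : 'I_n -> L) (U V : {poly L})
    (hU : U = \prod_(i < m) (1 - alpha i *: 'X))
    (hV : V = \prod_(j < n) (1 - beta j *: 'X)) :
  \prod_(i < m) \prod_(j < n) (1 - (alpha i * beta j) *: 'X)
    = (-1) ^+ (m * n) * sylvester_resultant m n (U^:P) (reversed_at n V)
  /\ ((forall i, alpha i != 0) ->
      forall r : {poly L},
        is_resultant (U^:P) (reversed_at n V) r <->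
        \prod_(i < m) \prod_(j < n) (1 - (alpha i * beta j) *: 'X)
          = (-1) ^+ (m * n) * r).
Proof.
pose s := [seq beta j | j <- enum 'I_n]; pose t := [seq b *: 'X | b <- s].
have size_s : size s = n by rewrite size_map size_enum_ord.
have size_t : size t = n by rewrite size_map.
have -> : reversed_at n V = \prod_(c <- t) ('X - c%:P).
  rewrite big_map -reversed_at_prod size_s hV; congr reversed_at.
  by rewrite big_map big_enum.
have -> : \prod_(i < m) \prod_(j < n) (1 - (alpha i * beta j) *: 'X)
    = \prod_(c <- t) (U^:P).[c].
  rewrite exchange_big 2!big_map big_enum /=; apply: eq_bigr => j _.
  rewrite hU rmorph_prod horner_prod; apply: eq_bigr => i _.
  rewrite rmorphB rmorph1 /= map_polyZ map_polyX !hornerE.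
  by rewrite mul_polyC scalerA.
have U1 : (size U <= m.+1)%N.
  have -> : U = \prod_(b <- [seq alpha i | i <- enum 'I_m]) (1 - b *: 'X).
    by rewrite big_map big_enum.
  by rewrite (leq_trans (size_prod_1subZX _)) // size_map size_enum_ord.
have signK (a b : {poly L}) :
    a = (-1) ^+ (m * n) * b <-> b = (-1) ^+ (m * n) * a.
  by split=> ->; rewrite mulrA -expr2 sqrr_sign mul1r.
split=> [|alpha0 r].
  apply/signK; rewrite -{1}size_t sylvester_resultant_prod_XsubC.
    by rewrite size_t.
  by rewrite size_map_polyC.
pose rho := [seq (alpha i)^-1 | i <- enum 'I_m].
(* The nonvanishing of the alpha_i is used here: 1 - alpha_i y has the root
   1 / alpha_i. *)
have defU : U = (\prod_(i < m) - alpha i) *: \prod_(a <- rho) ('X - a%:P).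
  rewrite [X in _ *: X]big_map big_enum -scaler_prod hU.
  apply: eq_bigr => i _.
  by rewrite scaleNr scalerBr opprB -alg_polyC scalerA mulfV // scale1r.
have u0 : \prod_(i < m) - alpha i != 0.
  by apply/prodf_neq0 => i _; rewrite oppr_eq0.
have lcU : lead_coef U = \prod_(i < m) - alpha i.
  by rewrite defU lead_coefZ (monicP (monic_prod_XsubC _ _ _)) mulr1.
have size_U : size (U^:P) = m.+1.
  rewrite size_map_polyC defU size_scale // size_prod_XsubC.
  by rewrite size_map size_enum_ord.
apply: iff_trans (signK _ _).
rewrite -[m in (-1) ^+ (m * _)]/(m.+1.-1) -{1}size_U -{1}size_t.
apply: (@is_resultant_prod_XsubC _ _ (@tofrac {poly L}) _
  [seq tofrac a%:P | a <- rho]).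
- by move=> p q /eqP; rewrite tofrac_eq => /eqP.
- by rewrite -size_poly_eq0 size_U.
rewrite lead_coef_map_inj //; last exact: polyC_inj.
rewrite lcU {1}defU map_polyZ /= map_polyZ /=; congr (_ *: _).
by rewrite !map_prod_XsubC [RHS]big_map.
Qed.
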